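(* Let $f,g:\mathbb{R}^{d_x}\times\mathbb{R}^{d_y}\to\mathbb{R}$ be such that: $g(x,y)$ is $\mu$-strongly convex in $y$, has $L_g$-Lipschitz gradient and $\rho_g$-Lipschitz Hessian; $f(x,y)$ is $C_f$-Lipschitz in $y$, has $L_f$-Lipschitz gradient and is twice continuously differentiable; and $\varphi(x)=f(x,y^*(x))$ is bounded below. Let $\ell=\max\{C_f,L_f,L_g,\rho_g\}$ and $\kappa=\ell/\mu$. Then for $\lambda\ge 2L_f/\mu$, the gradient $\nabla\mathcal{L}^*_\lambda(x)$ is $D_3$-Lipschitz, where $$D_3:=L_f+\frac{4L_fL_g}{\mu}+\frac{C_f\rho_g}{\mu}+\frac{C_fL_g\rho_g}{\mu^2}+L_gD_2=\mathcal{O}(\ell\kappa^3),\qquad D_2:=\Big(\frac1\mu+\frac{2L_g}{\mu^2}\Big)\Big(L_f+\frac{C_f\rho_g}{\mu}\Big).$$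
   Context: Lipschitz continuity of gradient/Hessian is with respect to the joint variable $(x,y)$. Here $y^*(x)=\arg\min_{y}g(x,y)$, $g^*(x)=g(x,y^*(x))$, $\mathcal{L}_\lambda(x,y)=f(x,y)+\lambda(g(x,y)-g^*(x))$, $y^*_\lambda(x)=\arg\min_y\mathcal{L}_\lambda(x,y)$ and $\mathcal{L}^*_\lambda(x)=\mathcal{L}_\lambda(x,y^*_\lambda(x))$; for $\lambda\ge2L_f/\mu$, $\mathcal{L}_\lambda(x,\cdot)$ is strongly convex so $y^*_\lambda$ is well defined. $\mathcal{O}(\cdot)$ hides an absolute constant. *)

(* Defs.v *)
From HB Require Import structures.
From mathcomp Require Import all_boot all_order all_algebra.
From mathcomp Require Import all_classical all_reals all_analysis.
Import Order.TTheory GRing.Theory Num.Theory.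
Import numFieldNormedType.Exports.

Set Implicit Arguments.
Unset Strict Implicit.
Unset Printing Implicit Defensive.

Local Open Scope classical_set_scope.
Local Open Scope ring_scope.

(* The library norm `|_| on matrices is the sup norm; the Lipschitz constants
   below refer to the Euclidean norm and to the operator norm it induces. *)
Definition enorm (R : realType) (n : nat) (v : 'rV[R]_n) : R :=
  Num.sqrt (\sum_(i < n) v 0 i ^+ 2).

Definition opnorm (R : realType) (m n : nat) (A : 'M[R]_(m, n)) : R :=
  sup [set enorm (v *m A) | v in [set v : 'rV[R]_m | enorm v <= 1]].

Definition lipschitz_for (R : realType) (V W : zmodType)
    (nV : V -> R) (nW : W -> R) (L : R) (F : V -> W) : Prop :=
  forall u v : V, nW (F u - F v) <= L * nV (u - v).

Definition gradient (R : realType) (n : nat) (F : 'rV[R]_n -> R)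
    (z : 'rV[R]_n) : 'rV[R]_n :=
  \row_(i < n) 'D_(delta_mx 0 i) F z.

(* Row i holds the partial derivatives of the gradient in direction i. *)
Definition hessian (R : realType) (n : nat) (F : 'rV[R]_n -> R)
    (z : 'rV[R]_n) : 'M[R]_n :=
  'J (gradient F) z.

Definition lipschitz_gradient (R : realType) (n : nat) (L : R)
    (F : 'rV[R]_n -> R) : Prop :=
  (forall z, differentiable F z) /\
  lipschitz_for (@enorm R n) (@enorm R n) L (gradient F).

Definition twice_differentiable (R : realType) (n : nat)
    (F : 'rV[R]_n -> R) : Prop :=
  (forall z, differentiable F z) /\ (forall z, differentiable (gradient F) z).

Definition lipschitz_hessian (R : realType) (n : nat) (rho : R)
    (F : 'rV[R]_n -> R) : Prop :=
  twice_differentiable F /\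
  lipschitz_for (@enorm R n) (@opnorm R n n) rho (hessian F).

Definition twice_continuously_differentiable (R : realType) (n : nat)
    (F : 'rV[R]_n -> R) : Prop :=
  twice_differentiable F /\ continuous (hessian F).

Definition strongly_convex (R : realType) (n : nat) (mu : R)
    (h : 'rV[R]_n -> R) : Prop :=
  forall (u v : 'rV[R]_n) (t : R), 0 <= t <= 1 ->
    h (t *: u + (1 - t) *: v) <=
      t * h u + (1 - t) * h v - mu / 2 * t * (1 - t) * enorm (u - v) ^+ 2.

(* h as a function of the joint variable (x, y) *)
Definition joint (R : realType) (dx dy : nat)
    (h : 'rV[R]_dx -> 'rV[R]_dy -> R) (z : 'rV[R]_(dx + dy)) : R :=
  h (lsubmx z) (rsubmx z).

(* A global minimizer of h, with default value 0 when there is none. *)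
Definition argmin (R : realType) (n : nat) (h : 'rV[R]_n -> R) : 'rV[R]_n :=
  xget 0 [set y | forall y', h y <= h y'].

Definition ystar (R : realType) (dx dy : nat)
    (g : 'rV[R]_dx -> 'rV[R]_dy -> R) (x : 'rV[R]_dx) : 'rV[R]_dy :=
  argmin (g x).

Definition gstar (R : realType) (dx dy : nat)
    (g : 'rV[R]_dx -> 'rV[R]_dy -> R) (x : 'rV[R]_dx) : R :=
  g x (ystar g x).

Definition phi (R : realType) (dx dy : nat)
    (f g : 'rV[R]_dx -> 'rV[R]_dy -> R) (x : 'rV[R]_dx) : R :=
  f x (ystar g x).

Definition Lagr (R : realType) (dx dy : nat)
    (f g : 'rV[R]_dx -> 'rV[R]_dy -> R) (lambda : R)
    (x : 'rV[R]_dx) (y : 'rV[R]_dy) : R :=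
  f x y + lambda * (g x y - gstar g x).

Definition ystar_lambda (R : realType) (dx dy : nat)
    (f g : 'rV[R]_dx -> 'rV[R]_dy -> R) (lambda : R)
    (x : 'rV[R]_dx) : 'rV[R]_dy :=
  argmin (Lagr f g lambda x).

Definition Lagr_star (R : realType) (dx dy : nat)
    (f g : 'rV[R]_dx -> 'rV[R]_dy -> R) (lambda : R) (x : 'rV[R]_dx) : R :=
  Lagr f g lambda x (ystar_lambda f g lambda x).

Definition ell (R : realType) (Cf Lf Lg rhog : R) : R :=
  Num.max Cf (Num.max Lf (Num.max Lg rhog)).

Definition kappa (R : realType) (mu Cf Lf Lg rhog : R) : R :=
  ell Cf Lf Lg rhog / mu.

Definition D2 (R : realType) (mu Cf Lf Lg rhog : R) : R :=
  (1 / mu + 2 * Lg / mu ^+ 2) * (Lf + Cf * rhog / mu).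

Definition D3 (R : realType) (mu Cf Lf Lg rhog : R) : R :=
  Lf + 4 * Lf * Lg / mu + Cf * rhog / mu + Cf * Lg * rhog / mu ^+ 2
  + Lg * D2 mu Cf Lf Lg rhog.

(* Main.v *)
(* By Danskin's theorem the gradient of L*_lambda at x is the x-part of
   grad f(x,yl) + lambda (grad g(x,yl) - grad g(x,y)), where y and yl minimize
   g(x,.) and f(x,.) + lambda g(x,.). Strong monotonicity in y makes y and yl
   Lipschitz in x and gives |yl - y| <= Cf / (lambda mu). The Lipschitz estimate
   is then obtained without differentiating y and yl, from the increments
   k = y' - y and kl = yl' - yl between x and x' = x + h: the second difference
     (grad g((x,yl) + (h,k)) - grad g(x,yl)) - (grad g((x,y) + (h,k)) - grad g(x,y))
   is at most rhog |yl - y| |(h,k)|, as the Hessian of g is rhog-Lipschitz. In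
   the y-part, where the gradients vanish at the minimizers, this bounds
   lambda |kl - k| by D2 |h|; in the x-part it then gives D3. *)

Require Import Defs.
From HB Require Import structures.
From mathcomp Require Import all_boot all_order all_algebra.
From mathcomp Require Import all_classical all_reals all_analysis.
From mathcomp Require Import ring lra.
Import Order.TTheory GRing.Theory Num.Theory.
Import numFieldNormedType.Exports.

Local Open Scope ring_scope.

(** * Inner product, Euclidean norm and operator norm on row vectors *)

Section EuclideanSpace.
Context {R : realType}.

Definition dotp {n} (u v : 'rV[R]_n) : R := \sum_(i < n) u 0 i * v 0 i.

Lemma dotpC {n} (u v : 'rV[R]_n) : dotp u v = dotp v u.
Proof. by apply: eq_bigr => i _; rewrite mulrC. Qed.

Lemma dotp_linear {n} (u v : 'rV[R]_n) a w :
  dotp (a *: u + v) w = a * dotp u w + dotp v w.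
Proof.
rewrite /dotp big_distrr -big_split /=; apply: eq_bigr => i _.
by rewrite !mxE; ring.
Qed.

Lemma dotpDl {n} (u v w : 'rV[R]_n) : dotp (u + v) w = dotp u w + dotp v w.
Proof. by rewrite -[u]scale1r dotp_linear scale1r mul1r. Qed.

Lemma dotp0l {n} (w : 'rV[R]_n) : dotp 0 w = 0.
Proof. by rewrite /dotp big1// => i _; rewrite mxE mul0r. Qed.

Lemma dotpZl {n} a (u w : 'rV[R]_n) : dotp (a *: u) w = a * dotp u w.
Proof. by rewrite -[a *: u]addr0 dotp_linear dotp0l addr0. Qed.

Lemma dotpNl {n} (u w : 'rV[R]_n) : dotp (- u) w = - dotp u w.
Proof. by rewrite -scaleN1r dotpZl mulN1r. Qed.

Lemma dotpBl {n} (u v w : 'rV[R]_n) : dotp (u - v) w = dotp u w - dotp v w.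
Proof. by rewrite dotpDl dotpNl. Qed.

Lemma dotpDr {n} (u v w : 'rV[R]_n) : dotp w (u + v) = dotp w u + dotp w v.
Proof. by rewrite !(dotpC w) dotpDl. Qed.

Lemma dotpZr {n} a (u w : 'rV[R]_n) : dotp w (a *: u) = a * dotp w u.
Proof. by rewrite !(dotpC w) dotpZl. Qed.

Lemma dotpNr {n} (u w : 'rV[R]_n) : dotp w (- u) = - dotp w u.
Proof. by rewrite !(dotpC w) dotpNl. Qed.

Lemma dotpBr {n} (u v w : 'rV[R]_n) : dotp w (u - v) = dotp w u - dotp w v.
Proof. by rewrite !(dotpC w) dotpBl. Qed.

Lemma dotp0r {n} (w : 'rV[R]_n) : dotp w 0 = 0.
Proof. by rewrite dotpC dotp0l. Qed.

Lemma dotp_row_mx {m n} (u u' : 'rV[R]_m) (v v' : 'rV[R]_n) :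
  dotp (row_mx u v) (row_mx u' v') = dotp u u' + dotp v v'.
Proof.
rewrite /dotp big_split_ord /=; congr (_ + _); apply: eq_bigr => i _.
  by rewrite !row_mxEl.
by rewrite !row_mxEr.
Qed.

Lemma dotp_mulmx {m n} (u : 'rV[R]_m) (A : 'M[R]_(m, n)) (v : 'rV[R]_n) :
  dotp (u *m A) v = dotp (v *m A^T) u.
Proof.
have dotpE k (a b : 'rV[R]_k) : dotp a b = (a *m b^T) 0 0.
  by rewrite mxE; apply: eq_bigr => i _; rewrite !mxE.
rewrite dotpC !dotpE; congr (fun_of_matrix _ 0 0).
by rewrite trmx_mul mulmxA.
Qed.

Lemma dotp_ge0 {n} (u : 'rV[R]_n) : 0 <= dotp u u.
Proof. by apply: sumr_ge0 => i _; rewrite -expr2 sqr_ge0. Qed.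

Lemma enorm_ge0 {n} (u : 'rV[R]_n) : 0 <= enorm u.
Proof. exact: sqrtr_ge0. Qed.

Lemma sqr_enorm {n} (u : 'rV[R]_n) : enorm u ^+ 2 = dotp u u.
Proof.
rewrite sqr_sqrtr; last by apply: sumr_ge0 => i _; rewrite sqr_ge0.
by apply: eq_bigr => i _; rewrite expr2.
Qed.

Lemma enorm_le {n} (u : 'rV[R]_n) c : 0 <= c -> dotp u u <= c ^+ 2 -> enorm u <= c.
Proof. by move=> c0 uc; rewrite -ler_sqr ?nnegrE ?enorm_ge0// sqr_enorm. Qed.

Lemma enorm0 {n} : enorm (0 : 'rV[R]_n) = 0.
Proof.
by apply/eqP; rewrite -sqrf_eq0 sqr_enorm dotp0l.
Qed.

Lemma enorm_eq0 {n} (u : 'rV[R]_n) : enorm u = 0 -> u = 0.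
Proof.
move=> u0; have : dotp u u == 0 by rewrite -sqr_enorm u0 expr0n.
rewrite psumr_eq0; last by move=> i _; rewrite -expr2 sqr_ge0.
move=> /allP /= h; apply/rowP => i; rewrite mxE.
by have := h i (mem_index_enum i); rewrite mulf_eq0 orbb => /eqP.
Qed.

Lemma enormN {n} (u : 'rV[R]_n) : enorm (- u) = enorm u.
Proof. by congr Num.sqrt; apply: eq_bigr => i _; rewrite mxE sqrrN. Qed.

Lemma enormZ {n} a (u : 'rV[R]_n) : enorm (a *: u) = `|a| * enorm u.
Proof.
apply/eqP; rewrite -(@eqrXn2 _ 2)// ?mulr_ge0 ?enorm_ge0//.
by rewrite exprMn !sqr_enorm dotpZl dotpZr real_normK ?num_real// mulrA expr2.
Qed.

Lemma cauchy_schwarz {n} (u v : 'rV[R]_n) : dotp u v <= enorm u * enorm v.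
Proof.
have := enorm_ge0 u; rewrite le_eqVlt => /predU1P[/esym/enorm_eq0 ->|u0].
  by rewrite dotp0l enorm0 mul0r.
have := enorm_ge0 v; rewrite le_eqVlt => /predU1P[/esym/enorm_eq0 ->|v0].
  by rewrite dotp0r enorm0 mulr0.
have := dotp_ge0 (enorm v *: u - enorm u *: v).
rewrite dotpBl !dotpBr !dotpZl !dotpZr -!sqr_enorm (dotpC v u).
set a := enorm u in u0 *; set b := enorm v in v0 * => H.
have ab0 : 0 < a * b by rewrite mulr_gt0.
by rewrite -(ler_pM2l ab0); nra.
Qed.

Lemma norm_dotp_le {n} (u v : 'rV[R]_n) : `|dotp u v| <= enorm u * enorm v.
Proof.
by rewrite ler_norml cauchy_schwarz andbT lerNl -dotpNl -(enormN u) cauchy_schwarz.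
Qed.

Lemma enormD {n} (u v : 'rV[R]_n) : enorm (u + v) <= enorm u + enorm v.
Proof.
apply: enorm_le; first by rewrite addr_ge0 ?enorm_ge0.
rewrite dotpDl !dotpDr sqrrD !sqr_enorm (dotpC v u).
by have := cauchy_schwarz u v; lra.
Qed.

Lemma enorm_sum {n} (I : Type) (r : seq I) (F : I -> 'rV[R]_n) :
  enorm (\sum_(i <- r) F i) <= \sum_(i <- r) enorm (F i).
Proof.
elim/big_ind2 : _ => [|u a v b ua vb|//]; first by rewrite enorm0.
by rewrite (le_trans (enormD _ _))// lerD.
Qed.

(** Taking [w := u] suffices. This duality reduces vector-valued increments to scalar functions, to
    which the mean value theorem applies. *)
Lemma enorm_of_dotp {n} (u : 'rV[R]_n) c : 0 <= c ->
  (forall w, dotp w u <= c * enorm w) -> enorm u <= c.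
Proof.
move=> c0 /(_ u); rewrite -sqr_enorm expr2.
have := enorm_ge0 u; rewrite le_eqVlt => /predU1P[<- //|u0].
by rewrite ler_pM2r.
Qed.

Lemma sqr_enorm_row_mx {m n} (u : 'rV[R]_m) (v : 'rV[R]_n) :
  enorm (row_mx u v) ^+ 2 = enorm u ^+ 2 + enorm v ^+ 2.
Proof. by rewrite !sqr_enorm dotp_row_mx. Qed.

Lemma enorm_row_mx0 {m n} (u : 'rV[R]_m) :
  enorm (row_mx u (0 : 'rV[R]_n)) = enorm u.
Proof.
apply/eqP; rewrite -(@eqrXn2 _ 2)// ?enorm_ge0//.
by rewrite sqr_enorm_row_mx enorm0 expr0n addr0.
Qed.

Lemma enorm_row_0mx {m n} (v : 'rV[R]_n) :
  enorm (row_mx (0 : 'rV[R]_m) v) = enorm v.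
Proof.
apply/eqP; rewrite -(@eqrXn2 _ 2)// ?enorm_ge0//.
by rewrite sqr_enorm_row_mx enorm0 expr0n add0r.
Qed.

Lemma enorm_row_mx {m n} (u : 'rV[R]_m) (v : 'rV[R]_n) :
  enorm (row_mx u v) <= enorm u + enorm v.
Proof.
have -> : row_mx u v = row_mx u 0 + row_mx 0 v by rewrite add_row_mx addr0 add0r.
by rewrite (le_trans (enormD _ _))// enorm_row_mx0 enorm_row_0mx.
Qed.

Lemma enorm_lsubmx {m n} (u : 'rV[R]_(m + n)) : enorm (lsubmx u) <= enorm u.
Proof.
rewrite -ler_sqr ?nnegrE ?enorm_ge0// -{2}[u]hsubmxK sqr_enorm_row_mx.
by rewrite lerDl sqr_ge0.
Qed.

Lemma enorm_rsubmx {m n} (u : 'rV[R]_(m + n)) : enorm (rsubmx u) <= enorm u.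
Proof.
rewrite -ler_sqr ?nnegrE ?enorm_ge0// -{2}[u]hsubmxK sqr_enorm_row_mx.
by rewrite lerDr sqr_ge0.
Qed.

Lemma norm_coord_le_enorm {n} (u : 'rV[R]_n) i : `|u 0 i| <= enorm u.
Proof.
rewrite -ler_sqr ?nnegrE ?enorm_ge0// real_normK ?num_real// sqr_enorm.
by rewrite /dotp (bigD1 i)//= -expr2 lerDl sumr_ge0// => j _; rewrite -expr2 sqr_ge0.
Qed.

(** With [enorm_le_mx_norm] this makes the two norms equivalent, so that differentiability, which
    the library states in the sup norm, transfers to the Euclidean one. *)
Lemma mx_norm_le_enorm {n} (u : 'rV[R]_n) : `|u| <= enorm u.
Proof.
rewrite [leLHS]/Num.norm /= mx_normrE; apply/bigmax_leP; split=> [|[i j] _ /=].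
  exact: enorm_ge0.
by rewrite ord1 norm_coord_le_enorm.
Qed.

Lemma enorm_le_mx_norm {n} (u : 'rV[R]_n) : enorm u <= n%:R * `|u|.
Proof.
rewrite [in leLHS](row_sum_delta u) (le_trans (enorm_sum _ _ _))//.
have -> : n%:R * `|u| = \sum_(i < n) `|u| by rewrite sumr_const card_ord mulr_natl.
apply: ler_sum => i _; rewrite enormZ.
have -> : enorm (delta_mx 0 i : 'rV[R]_n) = 1.
  rewrite -[RHS]sqrtr1; congr Num.sqrt.
  rewrite (bigD1 i)//= mxE !eqxx expr1n big1 ?addr0// => j ji.
  by rewrite mxE (negbTE ji) andbF expr0n.
rewrite mulr1 [leRHS]/Num.norm /= mx_normrE; apply/bigmax_geP; right => /=.
by exists (0, i).
Qed.

Lemma enorm_mulmx_opnorm {m n} (v : 'rV[R]_m) (A : 'M[R]_(m, n)) :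
  enorm (v *m A) <= opnorm A * enorm v.
Proof.
have := enorm_ge0 v; rewrite le_eqVlt => /predU1P[/esym/enorm_eq0 ->|v0].
  by rewrite mul0mx !enorm0 mulr0.
(* A [sup] dominates its set only once an upper bound is known; the sum of the row norms is one,
   since the coordinates of [u] are at most 1 in absolute value. *)
have ub : has_ubound [set enorm (v *m A) | v in [set v : 'rV[R]_m | enorm v <= 1]]%classic.
  exists (\sum_(i < m) enorm (row i A)) => _ [u /= u1 <-].
  rewrite mulmx_sum_row (le_trans (enorm_sum _ _ _))//; apply: ler_sum => i _.
  by rewrite enormZ ler_piMl ?enorm_ge0// (le_trans (norm_coord_le_enorm _ _)).
rewrite -ler_pdivrMr//.
have -> : enorm (v *m A) / enorm v = enorm (((enorm v)^-1 *: v) *m A).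
  by rewrite -scalemxAl enormZ ger0_norm ?invr_ge0 ?enorm_ge0// mulrC.
apply: ub_le_sup => //; exists ((enorm v)^-1 *: v) => //=.
by rewrite enormZ ger0_norm ?invr_ge0 ?enorm_ge0// mulVf// gt_eqF.
Qed.

End EuclideanSpace.

(** * Gradients as first-order expansions, the mean value theorem and stationarity of minimizers *)

Section Gradients.
Context {R : realType}.

(** Fréchet differentiability in the Euclidean norm, with the gradient as a parameter: sums, shifts
    and restrictions to one block of variables become computations on the expansion. *)
Definition has_grad {n} (F : 'rV[R]_n -> R) (z p : 'rV[R]_n) : Prop :=
  forall e, 0 < e -> exists2 d, 0 < d &
    forall v, enorm v < d -> `|F (z + v) - F z - dotp p v| <= e * enorm v.

Lemma differentiable_enorm {n} {W : normedModType R} (F : 'rV[R]_n -> W) z :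
  differentiable F z ->
  forall e, 0 < e -> exists2 d, 0 < d &
    forall v, enorm v < d -> `|F (z + v) - F z - 'd F z v| <= e * enorm v.
Proof.
move=> /diff_locally /eqaddoP dF e e0.
have /nbhs_ballP[d /= d0 Hd] := dF e e0; exists d => // v vd.
have vd' : `|v| < d by rewrite (le_lt_trans (mx_norm_le_enorm v)).
have := Hd v; rewrite -ball_normE /= sub0r normrN => /(_ vd') H.
rewrite [z + v]addrC -addrA -opprD (le_trans H)//.
by rewrite ler_wpM2l ?(ltW e0)// mx_norm_le_enorm.
Qed.

Lemma diff_gradient {n} (F : 'rV[R]_n -> R) z v :
  differentiable F z -> 'd F z v = dotp (gradient F z) v.
Proof.
move=> dF; rewrite [in LHS](row_sum_delta v) linear_sum /=.
by apply: eq_bigr => i _; rewrite linearZ /= mxE deriveE// mulrC.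
Qed.

Lemma has_grad_gradient {n} (F : 'rV[R]_n -> R) z :
  differentiable F z -> has_grad F z (gradient F z).
Proof.
move=> dF e e0; have [d d0 Hd] := differentiable_enorm F z dF e e0.
by exists d => // v /Hd; rewrite diff_gradient.
Qed.

Lemma has_grad_jacobian {m n} (G : 'rV[R]_m -> 'rV[R]_n) z w :
  differentiable G z ->
  has_grad (fun v => dotp (G v) w) z (w *m ('J G z)^T).
Proof.
move=> dG e e0.
(* Cauchy-Schwarz costs a factor [enorm w] and leaving the sup norm of the remainder costs [n%:R];
   the added 1 keeps the divisor positive. *)
have c0 : 0 < 1 + n%:R * enorm w by rewrite ltr_wpDr// mulr_ge0 ?enorm_ge0.
have [d d0 Hd] := differentiable_enorm G z dG _ (divr_gt0 e0 c0).
exists d => // v /Hd H.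
rewrite -dotp_mulmx /jacobian mul_rV_lin1 -!dotpBl.
rewrite (le_trans (norm_dotp_le _ _))//.
rewrite (le_trans (ler_wpM2r (enorm_ge0 _) (enorm_le_mx_norm _)))//.
rewrite mulrAC (le_trans (ler_wpM2l _ H))// ?mulr_ge0 ?enorm_ge0//.
rewrite mulrA ler_wpM2r ?enorm_ge0// mulrCA ger_pMr//.
by rewrite ler_pdivrMr// mul1r lerDr.
Qed.

(** [dotp p] is a continuous linear form with the remainder required of a differential, so
    uniqueness of the differential identifies it with ['d F z]. *)
Lemma has_grad_differentiable {n} (F : 'rV[R]_n -> R) z p :
  has_grad F z p -> differentiable F z /\ gradient F z = p.
Proof.
move=> Fp.
have linp : linear (dotp p) by move=> a u v; rewrite dotpDr dotpZr.
pose L := GRing.isLinear.Build R 'rV[R]_n R _ (dotp p) linp.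
pose df : {linear 'rV[R]_n -> R} := HB.pack (dotp p) L.
have dfc : continuous df.
  apply/bounded_linear_continuous/linear_boundedP; near=> r => v.
  rewrite (le_trans (norm_dotp_le p v))//.
  rewrite (le_trans (ler_wpM2l (enorm_ge0 p) (enorm_le_mx_norm v)))//.
  by rewrite mulrA ler_wpM2r//; near: r; exact: nbhs_pinfty_ge.
have Fo : F \o shift z = cst (F z) + df +o_ (0 : 'rV[R]_n) id.
  apply/eqaddoP => e e0.
  have c0 : 0 < 1 + n%:R :> R by rewrite ltr_wpDr.
  have [d d0 Hd] := Fp _ (divr_gt0 e0 c0).
  apply/nbhs_ballP; exists (d / (1 + n%:R)); first exact: divr_gt0.
  move=> v; rewrite -ball_normE /= sub0r normrN ltr_pdivlMr// => vd.
  have nv : enorm v <= `|v| * (1 + n%:R).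
    by rewrite mulrC (le_trans (enorm_le_mx_norm v))// ler_wpM2r// lerDr.
  have H := Hd v (le_lt_trans nv vd).
  rewrite -[_ v]/(F (v + z) - (F z + dotp p v)) [v + z]addrC opprD addrA (le_trans H)//.
  by rewrite -mulrA ler_wpM2l ?(ltW e0)// mulrC ler_pdivrMr.
have dE := diff_unique dfc Fo.
have dF : differentiable F z by apply/diff_locallyP; rewrite dE.
split=> //; apply/rowP => i; rewrite mxE deriveE// dE /= /df /=.
rewrite /dotp (bigD1 i)//= mxE !eqxx mulr1 big1 ?addr0// => j ji.
by rewrite mxE (negbTE ji) andbF mulr0.
Unshelve. all: by end_near. Qed.

Lemma has_gradD {n} (F G : 'rV[R]_n -> R) z p q :
  has_grad F z p -> has_grad G z q -> has_grad (fun v => F v + G v) z (p + q).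
Proof.
move=> Fp Gq e e0; have e20 : 0 < e / 2 by rewrite divr_gt0.
have [d d0 Hd] := Fp _ e20; have [d' d'0 Hd'] := Gq _ e20.
exists (Num.min d d'); first by rewrite lt_min d0.
move=> v; rewrite lt_min => /andP[/Hd h /Hd' h'].
rewrite dotpDl.
have -> : F (z + v) + G (z + v) - (F z + G z) - (dotp p v + dotp q v) =
  (F (z + v) - F z - dotp p v) + (G (z + v) - G z - dotp q v) by ring.
by rewrite (le_trans (ler_normD _ _))//; lra.
Qed.

Lemma has_gradZ {n} (F : 'rV[R]_n -> R) z p c :
  has_grad F z p -> has_grad (fun v => c * F v) z (c *: p).
Proof.
move=> Fp e e0; have c0 : 0 < `|c| + 1 by rewrite ltr_wpDl.
have [d d0 Hd] := Fp _ (divr_gt0 e0 c0).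
exists d => // v /Hd h; rewrite dotpZl.
have -> : c * F (z + v) - c * F z - c * dotp p v =
  c * (F (z + v) - F z - dotp p v) by ring.
rewrite normrM (le_trans (ler_wpM2l _ h))//.
rewrite mulrA ler_wpM2r ?enorm_ge0// mulrCA ger_pMr//.
by rewrite ler_pdivrMr// mul1r lerDl.
Qed.

Lemma has_gradB {n} (F G : 'rV[R]_n -> R) z p q :
  has_grad F z p -> has_grad G z q -> has_grad (fun v => F v - G v) z (p - q).
Proof.
move=> Fp /(has_gradZ _ _ _ (-1)) Gq.
have := has_gradD _ _ _ _ _ Fp Gq; rewrite scaleN1r.
by under eq_fun do rewrite mulN1r.
Qed.

Lemma has_grad_shift {n} (F : 'rV[R]_n -> R) a z p :
  has_grad F (a + z) p -> has_grad (fun v => F (a + v)) z p.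
Proof.
by move=> Fp e /Fp[d d0 Hd]; exists d => // v /Hd; rewrite addrA.
Qed.

Lemma has_grad_joint {m n} (h : 'rV[R]_m -> 'rV[R]_n -> R) x y p :
  has_grad (joint h) (row_mx x y) p -> has_grad (h x) y (rsubmx p).
Proof.
move=> hp e /hp[d d0 Hd]; exists d => // v vd.
have := Hd (row_mx 0 v); rewrite enorm_row_0mx => /(_ vd).
rewrite add_row_mx addr0 /joint !row_mxKl !row_mxKr.
by rewrite -{1}[p]hsubmxK dotp_row_mx dotp0r add0r.
Qed.

Lemma has_grad_MVT {n} (F : 'rV[R]_n -> R) (P : 'rV[R]_n -> 'rV[R]_n) a w :
  (forall z, has_grad F z (P z)) ->
  exists2 c : R, 0 < c < 1 & F (a + w) - F a = dotp (P (a + c *: w)) w.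
Proof.
move=> FP.
pose phi (t : R) : R := F (a + t *: w).
have dphi (t : R) : is_derive t 1 phi (dotp (P (a + t *: w)) w).
  have [dF gF] := has_grad_differentiable _ _ _ (FP (a + t *: w)).
  have E : (fun h : R => h^-1 *: ((phi \o shift t) (h *: 1) - phi t)) =
           (fun h : R => h^-1 *: ((F \o shift (a + t *: w)) (h *: w) - F (a + t *: w))).
    apply/funext => h; rewrite /phi /= [h *: 1]mulr1.
    by rewrite scalerDl addrCA.
  have dw : derivable F (a + t *: w) w by exact: diff_derivable.
  split; first by rewrite /derivable E.
  by rewrite /derive E -gF -diff_gradient// -deriveE.
have [|c] := @MVT R phi _ 0 1 ltr01 (fun t _ => dphi t).
  by apply: derivable_within_continuous => t _; exact: ex_derive.
rewrite in_itv /= => c01 H; exists c => //.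
by move: H; rewrite /phi scale1r scale0r addr0 subr0 mulr1.
Qed.

(** A nonzero [p] would let a short move along [- p] decrease [h] to first order. The factor [t]
    gives this move length [d / 2]. *)
Lemma has_grad_min {n} (h : 'rV[R]_n -> R) y p :
  has_grad h y p -> (forall y', h y <= h y') -> p = 0.
Proof.
move=> hp ymin; apply: enorm_eq0; apply/eqP; rewrite eq_le enorm_ge0 andbT.
apply/ler_addgt0Pl => e e0; rewrite addr0.
have [d d0 Hd] := hp e e0.
have := enorm_ge0 p; rewrite le_eqVlt => /predU1P[<-|p0]; first exact: ltW.
pose t := d / 2 / enorm p.
have t0 : 0 < t by rewrite !divr_gt0.
have nt : enorm (- t *: p) = t * enorm p by rewrite enormZ normrN gtr0_norm.
have td : t * enorm p < d by rewrite divfK ?gt_eqF//; lra.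
have := Hd (- t *: p); rewrite nt => /(_ td)/(le_trans (ler_norm _)).
rewrite dotpZr -sqr_enorm => H.
have {H} : t * enorm p ^+ 2 <= e * (t * enorm p).
  by have := ymin (y + - t *: p); lra.
by rewrite expr2 mulrA (mulrC e) ler_pM2l// mulr_gt0.
Qed.

End Gradients.

(** * Strong convexity and monotonicity, existence of minimizers, second differences *)

Section StrongMonotonicity.
Context {R : realType}.

(** First-order counterpart of strong convexity, stated for a gradient field. It survives, with a
    smaller constant, the addition of a field whose Lipschitz constant is below [m]; this
    accommodates an [f] that is not convex in [y]. *)
Definition strongly_monotone {n} (m : R) (P : 'rV[R]_n -> 'rV[R]_n) : Prop :=
  forall u v, m * enorm (u - v) ^+ 2 <= dotp (P u - P v) (u - v).

(** The convexity inequality at [v + t *: w] is compared with the first-order expansion there and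
    divided by [t]. A small fixed [t] with total error [e] replaces the limit. *)
Lemma strongly_convex_lower_bound {n} mu (h : 'rV[R]_n -> R) u v p :
  strongly_convex mu h -> has_grad h v p ->
  h v + dotp p (u - v) + mu / 2 * enorm (u - v) ^+ 2 <= h u.
Proof.
move=> cvx hp; set w := u - v.
have N0 := enorm_ge0 w; set N := enorm w in N0 *.
apply/ler_addgt0Pl => e e0.
have c0 : 0 < 2 * (1 + N) by rewrite mulr_gt0// ltr_wpDr.
have [d d0 Hd] := hp _ (divr_gt0 e0 c0).
have c1 : 0 < 1 + `|mu| * N ^+ 2 by rewrite ltr_wpDr// mulr_ge0 ?sqr_ge0.
(* The three conditions keep the point on the segment, keep it where the expansion holds, and make
   the loss from the factor [1 - t] at most [e / 2]; the remainder accounts for the other half. *)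
have [t t0 /and3P[t1 td te]] : exists2 t, 0 < t &
    [&& t <= 1, t * N < d & t * (1 + `|mu| * N ^+ 2) <= e].
  have dN : 0 < d / (1 + N) by rewrite divr_gt0// ltr_wpDr.
  exists (Num.min 1 (Num.min (d / (1 + N)) (e / (1 + `|mu| * N ^+ 2)))).
    by rewrite !lt_min ltr01 dN divr_gt0.
  set t := Num.min _ _.
  have /and3P[t1 td te] :
      [&& t <= 1, t <= d / (1 + N) & t <= e / (1 + `|mu| * N ^+ 2)].
    by rewrite /t !ge_min !lexx !orbT.
  have t0 : 0 < t by rewrite !lt_min ltr01 dN divr_gt0.
  rewrite t1 -ler_pdivlMr// te andbT /=.
  rewrite (@lt_le_trans _ _ (t * (1 + N)))// ?ltr_pM2l ?ltrDr//.
  by rewrite -ler_pdivlMr// ltr_wpDr.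
have nt : enorm (t *: w) = t * N by rewrite enormZ gtr0_norm.
have := Hd (t *: w); rewrite nt => /(_ td); rewrite ler_norml => /andP[H _].
have := cvx u v t; rewrite ltW//= t1 => /(_ isT).
have -> : t *: u + (1 - t) *: v = v + t *: w.
  by rewrite scalerBl scale1r scalerBr addrCA.
rewrite -/w -/N => K; rewrite dotpZr in H.
have eN : e / (2 * (1 + N)) * (t * N) <= t * (e / 2).
  rewrite mulrCA ler_pM2l// invfM mulrA mulrAC ler_pdivrMr ?ltr_wpDr//.
  by rewrite ler_wpM2l// ?divr_ge0// ?(ltW e0)// lerDr.
have mt : mu * t * N ^+ 2 <= e.
  have a0 : 0 <= t * N ^+ 2 by rewrite mulr_ge0 ?sqr_ge0// ltW.
  by apply: le_trans te; have := ler_wpM2r a0 (ler_norm mu); lra.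
rewrite -(ler_pM2l t0); nra.
Qed.

Lemma strongly_convex_monotone {n} mu (h : 'rV[R]_n -> R) P :
  strongly_convex mu h -> (forall z, has_grad h z (P z)) ->
  strongly_monotone mu P.
Proof.
move=> cvx hP u v.
have := strongly_convex_lower_bound mu h u v _ cvx (hP v).
have := strongly_convex_lower_bound mu h v u _ cvx (hP u).
rewrite dotpBl -(opprB u v) enormN dotpNr; lra.
Qed.

Lemma has_grad_sqr_dist {n} (v z : 'rV[R]_n) :
  has_grad (fun u => dotp (u - v) (u - v)) z (2 *: (z - v)).
Proof.
move=> e e0; exists e => // w we.
rewrite [z + w - v]addrAC; move: (z - v) => a.
rewrite dotpZl dotpDl !dotpDr (dotpC w a) -[dotp w w]sqr_enorm.
rewrite [X in `|X|](_ : _ = enorm w ^+ 2); last by ring.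
by rewrite ger0_norm ?sqr_ge0// expr2 ler_wpM2r ?enorm_ge0// ltW.
Qed.

(** The mean value theorem is applied to [h] minus [m / 2] times the squared distance to [v];
    monotonicity between the intermediate point and [v] absorbs the subtracted gradient. *)
Lemma strongly_monotone_lower_bound {n} m (h : 'rV[R]_n -> R) P u v :
  (forall z, has_grad h z (P z)) -> strongly_monotone m P ->
  h v + dotp (P v) (u - v) + m / 2 * enorm (u - v) ^+ 2 <= h u.
Proof.
move=> hP mono; set w := u - v.
have hQ z := has_gradB _ _ _ _ _ (hP z)
  (has_gradZ _ _ _ (m / 2) (has_grad_sqr_dist v z)).
have [c /andP[c0 c1]] := has_grad_MVT _ _ v w hQ.
rewrite /= subrr dotp0l mulr0 subr0 (addrC v w) subrK -/w => H.
have := mono (v + c *: w) v; rewrite (addrC v) addrK enormZ gtr0_norm// dotpZr.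
rewrite exprMn expr2 -!mulrA mulrCA ler_pM2l// dotpBl => K.
move: H; rewrite -sqr_enorm (addrC v) addrK dotpBl !dotpZl -sqr_enorm; lra.
Qed.

(** A minimizer must be shown to exist, as [argmin] otherwise returns 0. The quadratic lower bound
    at 0 confines the search to a compact ball, where continuity provides one. *)
Lemma strongly_monotone_argmin {n} m (h : 'rV[R]_n -> R) P :
  0 < m -> (forall z, has_grad h z (P z)) -> strongly_monotone m P ->
  P (argmin h) = 0.
Proof.
move=> m0 hP mono.
suff ymin : forall y', h (argmin h) <= h y' by exact: has_grad_min (hP _) ymin.
suff [y ymin] : exists y, forall y', h y <= h y'.
  rewrite /argmin; case: xgetP => [z _ //|/(_ y) []]; exact: ymin.
(* Beyond this radius the quadratic term [m / 2 * enorm y' ^+ 2] outweighs the linear loss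
   [enorm (P 0) * enorm y']. *)
pose r := 2 * enorm (P 0) / m.
have r0 : 0 <= r by rewrite divr_ge0 ?mulr_ge0 ?enorm_ge0// ltW.
pose A := [set y : 'rV[R]_n | `|y| <= r]%classic.
have cA : compact A.
  apply: bounded_closed_compact.
    by exists r; split; [exact: num_real|move=> M rM y /= /le_trans; apply; exact: ltW].
  rewrite (_ : A = closed_ball_ (fun y : 'rV[R]_n => `|y|) 0 r); last first.
    by apply/seteqP; split=> y; rewrite /A /closed_ball_ /= sub0r normrN.
  exact: closed_closed_ball_.
have ch : {within A, continuous h}%classic.
  apply: continuous_subspaceT => z; apply: differentiable_continuous.
  by have [] := has_grad_differentiable _ _ _ (hP z).
have A0 : A 0 by rewrite /A /= normr0.
have [y yA ymin] := EVT_min_rV (ex_intro _ _ A0) cA ch.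
exists y => y'; have [y'r|ry'] := leP `|y'| r; first by apply: ymin; rewrite inE.
apply: (@le_trans _ _ (h 0)); first by apply: ymin; rewrite inE.
have := strongly_monotone_lower_bound m h P y' 0 hP mono; rewrite subr0.
apply: le_trans; rewrite -addrA lerDl.
have := norm_dotp_le (P 0) y'; rewrite ler_norml => /andP[H _].
have K : r < enorm y' by rewrite (lt_le_trans ry')// mx_norm_le_enorm.
move: K; rewrite /r ltr_pdivrMr// => K.
have := enorm_ge0 y'; nra.
Qed.

Lemma enorm_le_of_dotp {n} m (p u : 'rV[R]_n) :
  m * enorm u ^+ 2 <= dotp p u -> m * enorm u <= enorm p.
Proof.
have := enorm_ge0 u; rewrite le_eqVlt => /predU1P[<- _|u0 H].
  by rewrite mulr0 enorm_ge0.
rewrite -(ler_pM2r u0) -mulrA -expr2 (le_trans H)//; exact: cauchy_schwarz.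
Qed.

(** The mean value theorem is applied once, to the difference of the two translates of [G] paired
    with [u]. Both Jacobians are then taken at the same [c], so their base points still differ by
    [a - b]. *)
Lemma jacobian_lipschitz_diff {n} rho (G : 'rV[R]_n -> 'rV[R]_n)
    (a b w : 'rV[R]_n) :
  (forall z, differentiable G z) ->
  lipschitz_for (@enorm R n) (@opnorm R n n) rho (jacobian G) ->
  enorm ((G (a + w) - G a) - (G (b + w) - G b)) <= rho * enorm (a - b) * enorm w.
Proof.
move=> dG lipJ.
have mulJ z z' : enorm (w *m ('J G z - 'J G z')) <= rho * enorm (z - z') * enorm w.
  by rewrite (le_trans (enorm_mulmx_opnorm _ _))// ler_wpM2r ?enorm_ge0// lipJ.
apply: enorm_of_dotp => [|u]; first exact: le_trans (enorm_ge0 _) (mulJ a b).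
have hF v := has_gradB _ _ _ _ _
  (has_grad_shift _ a v _ (has_grad_jacobian G (a + v) u (dG _)))
  (has_grad_shift _ b v _ (has_grad_jacobian G (b + v) u (dG _))).
have [c _] := has_grad_MVT _ _ 0 w hF.
rewrite !addr0 !add0r => H.
have increment_eq : dotp (G (a + w) - G a - (G (b + w) - G b)) u =
    dotp (w *m ('J G (a + c *: w) - 'J G (b + c *: w))) u.
  move: H; move: (G (a + w)) (G (b + w)) (G a) (G b) => ga' gb' ga gb.
  move: ('J G (a + c *: w)) ('J G (b + c *: w)) => A B H.
  by rewrite dotp_mulmx [(A - B)^T]linearB mulmxBr -H !dotpBl; ring.
rewrite dotpC increment_eq (le_trans (cauchy_schwarz _ _))// ler_wpM2r ?enorm_ge0//.
by rewrite (le_trans (mulJ _ _))// opprD addrACA subrr addr0.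
Qed.

End StrongMonotonicity.

(** * Lipschitz estimates for the penalty gradient, given abstract gradient fields *)

Section PenaltyGradient.
Context {R : realType} {m n : nat}.
Implicit Types P : 'rV[R]_(m + n) -> 'rV[R]_(m + n).

Lemma row_mxB (x x' : 'rV[R]_m) (y y' : 'rV[R]_n) :
  row_mx x y - row_mx x' y' = row_mx (x - x') (y - y').
Proof. by rewrite opp_row_mx add_row_mx. Qed.

(** Replaces the implicit function theorem: strong monotonicity at [x'] bounds the distance from [y]
    to the zero [y'] by the residual at [y], which is due to the change from [x] to [x'] alone. *)
Lemma partial_zero_lipschitz P a L x x' y y' :
  (forall x, strongly_monotone a (fun y => rsubmx (P (row_mx x y)))) ->
  lipschitz_for (@enorm R _) (@enorm R _) L P ->
  rsubmx (P (row_mx x y)) = 0 -> rsubmx (P (row_mx x' y')) = 0 ->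
  a * enorm (y' - y) <= L * enorm (x' - x).
Proof.
move=> mono lipP Py Py'.
have := enorm_le_of_dotp _ _ _ (mono x' y' y); rewrite Py' sub0r enormN.
move=> /le_trans; apply.
have -> : rsubmx (P (row_mx x' y)) =
    rsubmx (P (row_mx x' y) - P (row_mx x y)) by rewrite linearB /= Py subr0.
rewrite (le_trans (enorm_rsubmx _))// (le_trans (lipP _ _))//.
by rewrite row_mxB subrr enorm_row_mx0.
Qed.

Context (Gf Gg : 'rV[R]_(m + n) -> 'rV[R]_(m + n)) (mu Cf Lf Lg rho lambda : R).
Context (mu_gt0 : 0 < mu) (lambda_gt0 : 0 < lambda).
Context (lambda_ge : 2 * Lf / mu <= lambda) (mu_le_Lg : mu <= Lg).
Context (Cf_ge0 : 0 <= Cf) (Lf_ge0 : 0 <= Lf) (rho_ge0 : 0 <= rho).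
Context (lipf : lipschitz_for (@enorm R _) (@enorm R _) Lf Gf).
Context (lipg : lipschitz_for (@enorm R _) (@enorm R _) Lg Gg).
Context (Gf_bound : forall z, enorm (rsubmx (Gf z)) <= Cf).
Context (Gg_mono : forall x, strongly_monotone mu (fun y => rsubmx (Gg (row_mx x y)))).
Context (Gg_diff : forall a b w : 'rV[R]_(m + n),
  enorm ((Gg (a + w) - Gg a) - (Gg (b + w) - Gg b)) <= rho * enorm (a - b) * enorm w).

Definition penalty_grad (z : 'rV[R]_(m + n)) := Gf z + lambda *: Gg z.

Let lambdaP : 2 * Lf <= lambda * mu.
Proof. by rewrite -ler_pdivrMr. Qed.

(** The field [Gf] can destroy at most [Lf] of the monotonicity constant [lambda * mu], and [Lf] is
    at most half of it. *)
Lemma penalty_grad_mono x :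
  strongly_monotone (lambda * mu / 2) (fun y => rsubmx (penalty_grad (row_mx x y))).
Proof.
move=> u v; rewrite -linearB /penalty_grad opprD addrACA -scalerBr.
rewrite linearD linearZ /= dotpDl dotpZl [rsubmx (Gg _ - _)]linearB.
have := Gg_mono x u v; rewrite -(ler_pM2l lambda_gt0).
have := norm_dotp_le (rsubmx (Gf (row_mx x u) - Gf (row_mx x v))) (u - v).
rewrite ler_norml => /andP[H _].
have := lipf (row_mx x u) (row_mx x v); rewrite row_mxB subrr enorm_row_0mx.
move=> /(le_trans (enorm_rsubmx _)) K.
have := ler_wpM2r (enorm_ge0 (u - v)) K.
have := ler_wpM2r (sqr_ge0 (enorm (u - v))) lambdaP.
by rewrite expr2; lra.
Qed.

Lemma penalty_grad_lipschitz :
  lipschitz_for (@enorm R _) (@enorm R _) (Lf + lambda * Lg) penalty_grad.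
Proof.
move=> u v; rewrite /penalty_grad opprD addrACA -scalerBr.
rewrite (le_trans (enormD _ _))// enormZ gtr0_norm// mulrDl -mulrA.
by rewrite lerD ?ler_wpM2l ?(ltW lambda_gt0).
Qed.

Context (x x' : 'rV[R]_m) (y y' yl yl' : 'rV[R]_n).
Context (Gy : rsubmx (Gg (row_mx x y)) = 0) (Gy' : rsubmx (Gg (row_mx x' y')) = 0).
Context (Gyl : rsubmx (penalty_grad (row_mx x yl)) = 0).
Context (Gyl' : rsubmx (penalty_grad (row_mx x' yl')) = 0).

Let w := row_mx (x' - x) (y' - y).

(** Stationarity at [yl] makes [lambda] times the y-part of [Gg] the opposite of the y-part of [Gf],
    which is at most [Cf]. *)
Lemma penalty_min_dist : lambda * mu * enorm (yl - y) <= Cf.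
Proof.
have := enorm_le_of_dotp _ _ _ (Gg_mono x yl y); rewrite Gy subr0.
rewrite -(ler_pM2l lambda_gt0) mulrA => /le_trans; apply.
rewrite -[lambda in leLHS]gtr0_norm// -enormZ -enormN.
move: Gyl; rewrite /penalty_grad linearD /= linearZ /= => /eqP.
by rewrite addr_eq0 => /eqP <-.
Qed.

(** The quotient of [Lf + lambda * Lg] by [lambda * mu / 2] is bounded independently of [lambda],
    because [Lf] is at most [lambda * mu / 2]. *)
Lemma penalty_min_lipschitz : enorm (yl' - yl) <= (1 + 2 * Lg / mu) * enorm (x' - x).
Proof.
have lm0 : 0 < lambda * mu / 2 by rewrite divr_gt0 ?mulr_gt0.
rewrite -(ler_pM2l lm0); apply: le_trans
  (partial_zero_lipschitz _ _ _ _ _ _ _ penalty_grad_mono penalty_grad_lipschitz Gyl Gyl') _.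
rewrite mulrA.
rewrite ler_wpM2r ?enorm_ge0//.
have -> : lambda * mu / 2 * (1 + 2 * Lg / mu) = lambda * mu / 2 + lambda * Lg.
  by field; rewrite gt_eqF.
by rewrite lerD2r ler_pdivlMr// mulrC.
Qed.

(* Pythagoras for the joint increment [w] is essential: the triangle inequality
   would only give the factor [2 / mu + 2 * Lg / mu ^+ 2] in place of the
   [1 / mu + 2 * Lg / mu ^+ 2] of [D2]. *)
Lemma enorm_increment : 2 * mu * enorm w <= (mu + 2 * Lg) * enorm (x' - x).
Proof.
have H := partial_zero_lipschitz _ _ _ _ _ _ _ Gg_mono lipg Gy Gy'.
have h0 := enorm_ge0 (x' - x); have k0 := enorm_ge0 (y' - y).
have Lg0 : 0 <= Lg by rewrite (le_trans _ mu_le_Lg)// ltW.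
rewrite -ler_sqr ?nnegrE ?(mulr_ge0, addr_ge0, enorm_ge0, ltW mu_gt0)//.
rewrite exprMn sqr_enorm_row_mx.
have : (mu * enorm (y' - y)) ^+ 2 <= (Lg * enorm (x' - x)) ^+ 2.
  by rewrite ler_sqr ?nnegrE ?mulr_ge0 ?(ltW mu_gt0).
have : mu ^+ 2 * enorm (x' - x) ^+ 2 <= mu * Lg * enorm (x' - x) ^+ 2.
  by rewrite ler_wpM2r ?sqr_ge0// expr2 ler_pM2l.
have : 0 <= mu * Lg * enorm (x' - x) ^+ 2 by rewrite !mulr_ge0 ?sqr_ge0 ?(ltW mu_gt0).
by rewrite !exprMn; lra.
Qed.

(** The two base points are at distance of order [1 / lambda] by [penalty_min_dist], which cancels
    the factor [lambda]. *)
Lemma second_difference :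
  lambda * enorm ((Gg (row_mx x yl + w) - Gg (row_mx x yl))
    - (Gg (row_mx x' y') - Gg (row_mx x y))) <= Cf * rho / mu * enorm w.
Proof.
have -> : row_mx x' y' = row_mx x y + w by rewrite add_row_mx !subrKC.
rewrite mulrC -ler_pdivlMr// (le_trans (Gg_diff _ _ _))//.
rewrite row_mxB subrr enorm_row_0mx [leRHS]mulrAC ler_wpM2r ?enorm_ge0//.
rewrite (mulrC Cf) -!mulrA ler_wpM2l// -invfM ler_pdivlMr ?mulr_gt0//.
by rewrite mulrC (mulrC mu) penalty_min_dist.
Qed.

(** The zero [yl'] is compared with the predicted point [yl + (y' - y)], that is, [yl] moved by the
    increment of the lower-level minimizer. Strong monotonicity converts the residual at this
    prediction into a distance. *)
Lemma min_increment_diff :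
  lambda * enorm (yl' - yl - (y' - y)) <=
    D2 mu Cf Lf Lg rho * enorm (x' - x).
Proof.
set q := yl' - yl - (y' - y).
have zE : row_mx x yl + w = row_mx x' (yl + (y' - y)).
  by rewrite add_row_mx subrKC.
have qE : q = yl' - (yl + (y' - y)) by rewrite opprD addrA.
have H : lambda * mu / 2 * enorm q <= (Lf + Cf * rho / mu) * enorm w.
  have := enorm_le_of_dotp _ _ _ (penalty_grad_mono x' yl' (yl + (y' - y))).
  rewrite Gyl' sub0r enormN -qE -zE => /le_trans; apply.
  (* The y-parts vanish at [yl], [y] and [y'], so subtracting them changes nothing and exposes the
     second difference of [Gg]. *)
  have -> : rsubmx (penalty_grad (row_mx x yl + w)) =
      rsubmx ((Gf (row_mx x yl + w) - Gf (row_mx x yl)) +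
       lambda *: ((Gg (row_mx x yl + w) - Gg (row_mx x yl))
         - (Gg (row_mx x' y') - Gg (row_mx x y)))).
    set A := (X in _ = rsubmx X).
    have -> : A = (penalty_grad (row_mx x yl + w) - penalty_grad (row_mx x yl)) -
        lambda *: (Gg (row_mx x' y') - Gg (row_mx x y)).
      by rewrite /A /penalty_grad; apply/rowP => i; rewrite !mxE; ring.
    rewrite [RHS]linearB [in RHS]linearB linearZ linearB /= Gyl Gy Gy'.
    by rewrite subrr scaler0 !subr0.
  rewrite (le_trans (enorm_rsubmx _))// (le_trans (enormD _ _))//.
  rewrite mulrDl lerD//.
    by rewrite (le_trans (lipf _ _))// addrC addKr.
  by rewrite enormZ gtr0_norm// second_difference.
have c0 : 0 <= Lf + Cf * rho / mu by rewrite addr_ge0// divr_ge0 ?mulr_ge0// ltW.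
have K := ler_wpM2l c0 enorm_increment.
have m2 : 0 < mu ^+ 2 by rewrite exprn_gt0.
rewrite -(ler_pM2r m2) /D2.
have -> : (1 / mu + 2 * Lg / mu ^+ 2) * (Lf + Cf * rho / mu) * enorm (x' - x) * mu ^+ 2
   = (Lf + Cf * rho / mu) * ((mu + 2 * Lg) * enorm (x' - x)).
  by field; rewrite gt_eqF.
apply: le_trans K.
have := ler_wpM2l (ltW mu_gt0) H; move: (Lf + Cf * rho / mu) => c; lra.
Qed.

Lemma penalty_grad_diff :
  enorm (lsubmx (penalty_grad (row_mx x' yl') - lambda *: Gg (row_mx x' y'))
    - lsubmx (penalty_grad (row_mx x yl) - lambda *: Gg (row_mx x y)))
  <= D3 mu Cf Lf Lg rho * enorm (x' - x).
Proof.
rewrite -linearB (le_trans (enorm_lsubmx _))//.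
have zE : row_mx x yl + w = row_mx x' (yl + (y' - y)).
  by rewrite add_row_mx subrKC.
set D := (Gg (row_mx x yl + w) - Gg (row_mx x yl))
    - (Gg (row_mx x' y') - Gg (row_mx x y)).
(* Three contributions: the increment of [Gf], the error of the predicted point (the [D2] term), and
   the second difference [D]. *)
have -> : penalty_grad (row_mx x' yl') - lambda *: Gg (row_mx x' y')
      - (penalty_grad (row_mx x yl) - lambda *: Gg (row_mx x y)) =
    (Gf (row_mx x' yl') - Gf (row_mx x yl)) +
    (lambda *: (Gg (row_mx x' yl') - Gg (row_mx x yl + w)) + lambda *: D).
  by rewrite /penalty_grad /D -scalerDr; apply/rowP => i; rewrite !mxE; ring.
have Lg0 : 0 <= Lg by rewrite (le_trans _ mu_le_Lg)// ltW.
have h0 := enorm_ge0 (x' - x).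
have H1 : enorm (Gf (row_mx x' yl') - Gf (row_mx x yl)) <=
    Lf * ((2 + 2 * Lg / mu) * enorm (x' - x)).
  rewrite (le_trans (lipf _ _))// ler_wpM2l// row_mxB (le_trans (enorm_row_mx _ _))//.
  by have := penalty_min_lipschitz; lra.
have H2 : enorm (lambda *: (Gg (row_mx x' yl') - Gg (row_mx x yl + w))) <=
    Lg * (D2 mu Cf Lf Lg rho * enorm (x' - x)).
  rewrite enormZ gtr0_norm//.
  rewrite (le_trans (ler_wpM2l (ltW lambda_gt0) (lipg _ _)))//.
  rewrite mulrCA ler_wpM2l// zE row_mxB subrr enorm_row_0mx opprD addrA.
  exact: min_increment_diff.
have H3 : enorm (lambda *: D) <= Cf * rho / mu * ((1 + Lg / mu) * enorm (x' - x)).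
  rewrite enormZ gtr0_norm// (le_trans second_difference)// ler_wpM2l//.
    by rewrite divr_ge0 ?mulr_ge0// ltW.
  rewrite (le_trans (enorm_row_mx _ _))// mulrDl mul1r lerD2l.
  rewrite mulrAC ler_pdivlMr// mulrC.
  exact: partial_zero_lipschitz Gg_mono lipg Gy Gy'.
rewrite (le_trans (enormD _ _))// (le_trans (lerD H1 (enormD _ _)))//.
rewrite (le_trans (lerD (lexx _) (lerD H2 H3)))//.
rewrite /D3 -subr_ge0.
set d2 := D2 _ _ _ _ _.
(* The estimates leave a slack in the [Lf] terms, since [2 + 2 * Lg / mu] is at most
   [1 + 4 * Lg / mu] when [mu <= Lg]. *)
have -> : (Lf + 4 * Lf * Lg / mu + Cf * rho / mu + Cf * Lg * rho / mu ^+ 2 + Lg * d2) *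
    enorm (x' - x) -
    (Lf * ((2 + 2 * Lg / mu) * enorm (x' - x)) +
     (Lg * (d2 * enorm (x' - x)) + Cf * rho / mu * ((1 + Lg / mu) * enorm (x' - x))))
  = Lf * enorm (x' - x) / mu * (2 * Lg - mu) by field; rewrite gt_eqF.
apply: mulr_ge0; first by rewrite divr_ge0 ?mulr_ge0// ltW.
by move: mu_gt0 mu_le_Lg; lra.
Qed.

End PenaltyGradient.

(** * Differentiating along a minimizer map, signs of the constants, and the order of [D3] *)

Section ValueFunction.
Context {R : realType}.

Lemma has_grad_cst {n} (c : R) (z : 'rV[R]_n) : has_grad (fun=> c) z 0.
Proof.
move=> e e0; exists 1 => // v _.
by rewrite dotp0l subrr subr0 normr0 mulr_ge0 ?enorm_ge0// ltW.
Qed.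

(** The expansion along a short multiple of [p] itself shows a slope [enorm p], which the Lipschitz
    bound caps. *)
Lemma has_grad_norm_le {n} C (h : 'rV[R]_n -> R) y p :
  0 <= C -> lipschitz_for (@enorm R n) Num.norm C h -> has_grad h y p ->
  enorm p <= C.
Proof.
move=> C0 liph hp; apply/ler_addgt0Pl => e e0; have [d d0 Hd] := hp e e0.
have := enorm_ge0 p; rewrite le_eqVlt => /predU1P[<-|p0].
  by rewrite addr_ge0// ltW.
pose t := d / 2 / enorm p.
have t0 : 0 < t by rewrite !divr_gt0.
have nt : enorm (t *: p) = t * enorm p by rewrite enormZ gtr0_norm.
have td : t * enorm p < d by rewrite divfK ?gt_eqF//; lra.
have := Hd (t *: p); rewrite nt => /(_ td).
rewrite dotpZr -sqr_enorm ler_norml => /andP[H _].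
have := liph (y + t *: p) y; rewrite (addrC y) addrK nt ler_norml => /andP[_ K].
have tp : 0 < t * enorm p by rewrite mulr_gt0.
rewrite -(ler_pM2l tp); rewrite (addrC y) in H; nra.
Qed.

(* Danskin: the inner variable does not contribute when the gradient in that
   variable is orthogonal to its increments, in particular at a minimizer. *)
Lemma has_grad_along {m n} (F : 'rV[R]_(m + n) -> R) (y : 'rV[R]_m -> 'rV[R]_n) K x p :
  has_grad F (row_mx x (y x)) p ->
  (forall x', enorm (y x' - y x) <= K * enorm (x' - x)) ->
  (forall x', dotp (rsubmx p) (y x' - y x) = 0) ->
  has_grad (fun x => F (row_mx x (y x))) x (lsubmx p).
Proof.
move=> Fp yK yp e e0.
have c0 : 0 < 1 + `|K| by rewrite ltr_wpDr.
have [d d0 Hd] := Fp _ (divr_gt0 e0 c0).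
exists (d / (1 + `|K|)); first exact: divr_gt0.
move=> v; rewrite ltr_pdivlMr// => vd.
set w := row_mx v (y (x + v) - y x).
have wv : enorm w <= enorm v * (1 + `|K|).
  rewrite (le_trans (enorm_row_mx _ _))// mulrDr mulr1 lerD2l.
  have := yK (x + v); rewrite (addrC x) addrK => /le_trans; apply.
  by rewrite mulrC ler_wpM2l ?enorm_ge0// ler_norm.
have := Hd w (le_lt_trans wv vd).
rewrite {1}/w add_row_mx subrKC -[p in dotp p w]hsubmxK dotp_row_mx yp addr0.
move=> /le_trans; apply.
by rewrite mulrAC ler_pdivrMr// -mulrA ler_wpM2l ?(ltW e0).
Qed.

Lemma has_grad_eq0_cst {n} (h : 'rV[R]_n -> R) u v :
  (forall z, has_grad h z 0) -> h u = h v.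
Proof.
move=> h0; have [c _] := has_grad_MVT h (fun=> 0) v (u - v) h0.
by rewrite dotp0l subrKC => /subr0_eq.
Qed.

Lemma exists_enorm_gt0 n : (0 < n)%N -> exists u : 'rV[R]_n, 0 < enorm u.
Proof.
move=> n0; exists (const_mx 1); rewrite lt_neqAle enorm_ge0 andbT eq_sym.
apply/eqP => /enorm_eq0/rowP/(_ (Ordinal n0)); rewrite !mxE => /eqP.
by rewrite oner_eq0.
Qed.

(** The signs of the Lipschitz constants are not assumed; a nonzero vector forces them. *)
Lemma lipschitz_for_ge0 {n} (W : zmodType) (N : W -> R) L (F : 'rV[R]_n -> W) :
  (0 < n)%N -> (forall w, 0 <= N w) -> lipschitz_for (@enorm R n) N L F -> 0 <= L.
Proof.
move=> /exists_enorm_gt0[u u0] N0 /(_ u 0); rewrite subr0 => /(le_trans (N0 _)).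
by rewrite pmulr_lge0.
Qed.

Lemma opnorm_ge0 {m n} (A : 'M[R]_(m, n)) : (0 < m)%N -> 0 <= opnorm A.
Proof.
move=> /exists_enorm_gt0[u u0].
have := le_trans (enorm_ge0 _) (enorm_mulmx_opnorm u A).
by rewrite pmulr_lge0.
Qed.

(** Yields [mu <= Lg], hence a condition number of at least 1. *)
Lemma strongly_monotone_le_lipschitz {n} m L (P : 'rV[R]_n -> 'rV[R]_n) :
  (0 < n)%N -> strongly_monotone m P ->
  (forall u v, enorm (P u - P v) <= L * enorm (u - v)) -> m <= L.
Proof.
move=> /exists_enorm_gt0[u u0] mono lipP.
have := enorm_le_of_dotp _ _ _ (mono u 0); rewrite subr0.
by have := lipP u 0; rewrite subr0 => /[swap] /le_trans /[apply]; rewrite ler_pM2r.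
Qed.

(** Written in the ratios [Lg / mu] and [rho / mu], both at most [k], the five terms of [D3]
    contribute 1, 4, 1, 1 and 6 times [l * k ^+ 3], since [1 <= k]. *)
Lemma D3_le_ell_kappa (mu Cf Lf Lg rho : R) :
  0 < mu -> mu <= Lg -> 0 <= Cf -> 0 <= Lf -> 0 <= rho ->
  0 <= D3 mu Cf Lf Lg rho
    <= 13 * (ell Cf Lf Lg rho * kappa mu Cf Lf Lg rho ^+ 3).
Proof.
move=> mu0 muLg Cf0 Lf0 rho0.
rewrite /kappa; set l := ell _ _ _ _; set k := l / mu.
have [[Cfl Lfl] [Lgl rhol]] : (Cf <= l /\ Lf <= l) /\ (Lg <= l /\ rho <= l).
  by rewrite /l /ell !le_max !lexx !orbT.
have k1 : 1 <= k by rewrite ler_pdivlMr// mul1r (le_trans muLg).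
have l0 : 0 <= l by exact: le_trans Lfl.
have a0 : 0 <= Lg / mu by rewrite divr_ge0// ltW// (lt_le_trans mu0).
have r0 : 0 <= rho / mu by rewrite divr_ge0// ltW.
have ak : Lg / mu <= k by rewrite ler_pM2r ?invr_gt0.
have rk : rho / mu <= k by rewrite ler_pM2r ?invr_gt0.
have -> : D3 mu Cf Lf Lg rho =
  Lf + 4 * (Lf * (Lg / mu)) + Cf * (rho / mu) + Cf * (rho / mu) * (Lg / mu)
  + (Lg / mu) * (1 + 2 * (Lg / mu)) * (Lf + Cf * (rho / mu)).
  by rewrite /D3 /D2; field; rewrite gt_eqF.
move: (Lg / mu) (rho / mu) a0 r0 ak rk => a r a0 r0 ak rk.
have k0 : 0 <= k by rewrite (le_trans a0).
apply/andP; split; first by rewrite !(addr_ge0, mulr_ge0).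
have Lfa : Lf * a <= l * k by rewrite ler_pM.
have Cfr : Cf * r <= l * k by rewrite ler_pM.
have Cfra : Cf * r * a <= l * k * k by rewrite ler_pM ?mulr_ge0.
have last_term : a * (1 + 2 * a) * (Lf + Cf * r) <= k * (1 + 2 * k) * (l + l * k).
  by rewrite !ler_pM ?mulr_ge0 ?addr_ge0 ?mulr_ge0// ?lerD// ler_pM2l.
have k2 : k <= k ^+ 2 by rewrite expr2 ler_peMl.
have k3 : k ^+ 2 <= k ^+ 3 by rewrite [leRHS]exprS ler_peMl ?sqr_ge0.
have lk : l <= l * k by rewrite ler_peMr.
have lk2 : l * k <= l * k ^+ 2 by rewrite ler_wpM2l.
have lk3 : l * k ^+ 2 <= l * k ^+ 3 by rewrite ler_wpM2l.
by lra.
Qed.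

End ValueFunction.

(** * The bilevel problem: the abstract estimates applied to [f] and [g] *)

Section Bilevel.
Context {R : realType} {dx dy : nat}.
Context (f g : 'rV[R]_dx -> 'rV[R]_dy -> R) (mu Cf Lf Lg rhog : R).
Context (dy_gt0 : (0 < dy)%N) (mu_gt0 : 0 < mu).
Context (g_cvx : forall x, strongly_convex mu (g x)).
Context (g_lip : lipschitz_gradient Lg (joint g)).
Context (g_hess : lipschitz_hessian rhog (joint g)).
Context (f_lip_y : forall x, lipschitz_for (@enorm R dy) Num.norm Cf (f x)).
Context (f_lip : lipschitz_gradient Lf (joint f)).

Let Gf := gradient (joint f).
Let Gg := gradient (joint g).

Let Gf_grad z : has_grad (joint f) z (Gf z).
Proof. by apply: has_grad_gradient; have [+ _] := f_lip; exact. Qed.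

Let Gg_grad z : has_grad (joint g) z (Gg z).
Proof. by apply: has_grad_gradient; have [+ _] := g_lip; exact. Qed.

Let joint_row_mx (h : 'rV[R]_dx -> 'rV[R]_dy -> R) x y : joint h (row_mx x y) = h x y.
Proof. by rewrite /joint row_mxKl row_mxKr. Qed.

Let dxy_gt0 : (0 < dx + dy)%N.
Proof. by rewrite addn_gt0 dy_gt0 orbT. Qed.

Let Gg_mono x : strongly_monotone mu (fun y => rsubmx (Gg (row_mx x y))).
Proof.
apply: strongly_convex_monotone (g_cvx x) _ => y.
exact/has_grad_joint/Gg_grad.
Qed.

Let mu_le_Lg : mu <= Lg.
Proof.
apply: (strongly_monotone_le_lipschitz _ _ _ dy_gt0 (Gg_mono 0)) => u v.
rewrite -linearB (le_trans (enorm_rsubmx _))// (le_trans (g_lip.2 _ _))//.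
by rewrite row_mxB subrr enorm_row_0mx.
Qed.

Let Cf_ge0 : 0 <= Cf.
Proof. by apply: lipschitz_for_ge0 dy_gt0 _ (f_lip_y 0) => w. Qed.

Let Lf_ge0 : 0 <= Lf.
Proof. exact: lipschitz_for_ge0 dxy_gt0 enorm_ge0 f_lip.2. Qed.

Let rhog_ge0 : 0 <= rhog.
Proof.
by apply: lipschitz_for_ge0 dxy_gt0 _ g_hess.2 => A; exact: opnorm_ge0.
Qed.

Lemma D3_bounds : 0 <= D3 mu Cf Lf Lg rhog
  <= 13 * (ell Cf Lf Lg rhog * kappa mu Cf Lf Lg rhog ^+ 3).
Proof. exact: D3_le_ell_kappa. Qed.

Let lower_stationary x : rsubmx (Gg (row_mx x (ystar g x))) = 0.
Proof.
apply: (strongly_monotone_argmin mu (g x) (fun y => rsubmx (Gg (row_mx x y)))) => //.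
by move=> y; exact/has_grad_joint/Gg_grad.
Qed.

Lemma Lagr_star_lipschitz lambda : 0 < lambda -> 2 * Lf / mu <= lambda ->
  lipschitz_gradient (D3 mu Cf Lf Lg rhog) (Lagr_star f g lambda).
Proof.
move=> lambda_gt0 lambda_ge.
pose P := penalty_grad Gf Gg lambda.
have P_mono := penalty_grad_mono Gf Gg mu Lf lambda mu_gt0 lambda_gt0 lambda_ge
  f_lip.2 Gg_mono.
have P_lip := penalty_grad_lipschitz Gf Gg Lf Lg lambda lambda_gt0 f_lip.2 g_lip.2.
have upper_stationary x : rsubmx (P (row_mx x (ystar_lambda f g lambda x))) = 0.
  apply: (strongly_monotone_argmin (lambda * mu / 2) (Lagr f g lambda x)
    (fun y => rsubmx (P (row_mx x y)))) => //; first by rewrite divr_gt0 ?mulr_gt0.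
  move=> y; rewrite /P /penalty_grad linearD linearZ /=.
  (* The subtracted 0 is the gradient in [y] of the constant [gstar g x]. *)
  rewrite -[rsubmx (Gg _)]subr0.
  apply: has_gradD; first exact: has_grad_joint (Gf_grad _).
  apply: has_gradZ; apply: has_gradB; last exact: has_grad_cst.
  exact: has_grad_joint (Gg_grad _).
pose z x := row_mx x (ystar g x).
pose zl x := row_mx x (ystar_lambda f g lambda x).
(* This splits the function into two value functions, along [zl] and along [z], each with an inner
   variable stationary for its own integrand, so that [has_grad_along] applies to both. *)
have LE : Lagr_star f g lambda =
    fun x => (joint f (zl x) + lambda * joint g (zl x)) - lambda * joint g (z x).
  apply/funext => x; rewrite /zl /z !joint_row_mx.
  by rewrite /Lagr_star /Lagr /gstar; ring.
pose G x := lsubmx (P (zl x) - lambda *: Gg (z x)).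
have LG x : has_grad (Lagr_star f g lambda) x (G x).
  rewrite LE /G linearB linearZ /=; apply: has_gradB; last first.
    apply: has_gradZ; apply: (has_grad_along _ (ystar g) (Lg / mu)).
    - exact: Gg_grad.
    - move=> x'; rewrite mulrAC ler_pdivlMr// mulrC.
      exact: partial_zero_lipschitz Gg_mono g_lip.2 _ _.
    - by move=> x'; rewrite lower_stationary dotp0l.
  apply: (has_grad_along (fun v => joint f v + lambda * joint g v)
    (ystar_lambda f g lambda) (1 + 2 * Lg / mu)).
  - exact: has_gradD (Gf_grad _) (has_gradZ _ _ _ _ (Gg_grad _)).
  - move=> x'.
    exact: (penalty_min_lipschitz Gf Gg mu Lf Lg lambda mu_gt0 lambda_gt0 lambda_ge
      f_lip.2 g_lip.2 Gg_mono).
  - by move=> x'; rewrite upper_stationary dotp0l.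
have GE x := (has_grad_differentiable _ _ _ (LG x)).2.
split=> [x|x' x]; first exact: (has_grad_differentiable _ _ _ (LG x)).1.
rewrite !GE; apply: penalty_grad_diff => //.
- exact: f_lip.2.
- exact: g_lip.2.
- move=> v; rewrite -[v]hsubmxK.
  exact: has_grad_norm_le Cf_ge0 (f_lip_y _) (has_grad_joint _ _ _ _ (Gf_grad _)).
- by move=> a b w; apply: jacobian_lipschitz_diff => [u|]; [exact: g_hess.1.2|exact: g_hess.2].
Qed.

(* For [lambda = 0] the gradient of [f] is constant; [f x] need not have a
   minimizer, in which case [argmin] returns its default value [0]. *)
Lemma Lagr_star0_lipschitz : Lf = 0 ->
  lipschitz_gradient (D3 mu Cf Lf Lg rhog) (Lagr_star f g 0).
Proof.
move=> Lf_eq0.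
have GfE z : Gf z = Gf 0.
  apply/subr0_eq/enorm_eq0/eqP; rewrite eq_le enorm_ge0 andbT.
  by have := f_lip.2 z 0; rewrite Lf_eq0 mul0r.
have LE : Lagr_star f g 0 = fun x => joint f (row_mx x 0).
  apply/funext => x; rewrite joint_row_mx /Lagr_star /ystar_lambda.
  have -> : Lagr f g 0 x = f x by apply/funext => y; rewrite /Lagr mul0r addr0.
  rewrite /argmin; case: xgetP => [y _ ymin|_ //].
  (* If a minimizer exists, the y-part of the constant gradient is zero, so [f x] is constant and
     its minimum equals its value at the default point 0. *)
  have fy y' := has_grad_joint _ _ _ _ (Gf_grad (row_mx x y')).
  apply: has_grad_eq0_cst => y'.
  have := fy y'; rewrite GfE -(GfE (row_mx x y)).
  by rewrite (has_grad_min _ _ _ (fy y) ymin).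
have LG x : has_grad (Lagr_star f g 0) x (lsubmx (Gf 0)).
  rewrite LE; apply: (has_grad_along _ (fun=> 0) 0).
  - by rewrite -(GfE (row_mx x 0)).
  - by move=> x'; rewrite subrr enorm0 mul0r.
  - by move=> x'; rewrite subrr dotp0r.
split=> [x|x x']; first exact: (has_grad_differentiable _ _ _ (LG x)).1.
rewrite !(has_grad_differentiable _ _ _ (LG _)).2 subrr enorm0.
by rewrite mulr_ge0 ?enorm_ge0//; have /andP[] := D3_bounds.
Qed.

End Bilevel.

Theorem lemmaB7 (R : realType) :
  exists C : R,
  forall (dx dy : nat) (f g : 'rV[R]_dx -> 'rV[R]_dy -> R)
         (mu Cf Lf Lg rhog : R),
    (0 < dx)%N -> (0 < dy)%N -> 0 < mu ->
    (forall x, strongly_convex mu (g x)) ->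
    lipschitz_gradient Lg (joint g) ->
    lipschitz_hessian rhog (joint g) ->
    (forall x, lipschitz_for (@enorm R dy) Num.norm Cf (f x)) ->
    lipschitz_gradient Lf (joint f) ->
    twice_continuously_differentiable (joint f) ->
    (exists m : R, forall x, m <= phi f g x) ->
    (forall lambda : R, 2 * Lf / mu <= lambda ->
       lipschitz_gradient (D3 mu Cf Lf Lg rhog) (Lagr_star f g lambda)) /\
    D3 mu Cf Lf Lg rhog <=
      C * (ell Cf Lf Lg rhog * kappa mu Cf Lf Lg rhog ^+ 3).
Proof.
exists 13 => dx dy f g mu Cf Lf Lg rhog _ dy0 mu0 cvx lipg hessg lipfy lipf _ _.
have bounds := D3_bounds f g mu Cf Lf Lg rhog dy0 mu0 cvx lipg hessg lipfy lipf.
split; last by have /andP[] := bounds.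
move=> lambda lambda_ge.
have Lf0 : 0 <= Lf.
  by apply: lipschitz_for_ge0 lipf.2; [rewrite addn_gt0 dy0 orbT|exact: enorm_ge0].
have : 0 <= lambda by apply: le_trans lambda_ge; rewrite divr_ge0 ?mulr_ge0// ltW.
(* The value [lambda = 0] is admissible only when [Lf = 0]; the penalty then gives no strong
   convexity, so this case is separate. *)
rewrite le_eqVlt => /predU1P[lambda0|lambda_gt0].
  rewrite -lambda0 in lambda_ge *; apply: Lagr_star0_lipschitz => //.
  by move: lambda_ge; rewrite ler_pdivrMr// mul0r; lra.
exact: Lagr_star_lipschitz.
Qed.
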